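(* Let $(\mathcal{I},\mathcal{O},\Delta)$ be a task and let $\mathsf{Exec}$ be the set of full-information executions of a model of computation with initial configurations chosen according to $\mathcal{I}$, with protocol complex $\mathcal{P}$, execution map $\Xi$, finite-time protocol complexes $\mathcal{P}|_T$ and finite-time execution maps $\Xi_T$. If $V(\mathcal{P})$ is compact, then the following are equivalent: 1. The task $(\mathcal{I},\mathcal{O},\Delta)$ is solvable. 2. There is a continuous chromatic simplicial map $\delta:\mathcal{P}\to\mathcal{O}$ such that $\delta\circ\Xi$ is carried by $\Delta$. 3. There is a time $T\ge0$ such that there exists a chromatic simplicial map $\delta_T:\mathcal{P}|_T\to\mathcal{O}$ such that $\delta_T\circ\Xi_T$ is carried by $\Delta$. 4. The task $(\mathcal{I},\mathcal{O},\Delta)$ is solvable in a bounded number of local steps per process.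
   Context: **Complexes and tasks.** $\Pi$ is a set of $n$ processes. A simplicial complex is a (possibly infinite) collection of finite subsets (simplexes) of a vertex set, closed under containment; it is chromatic if its vertices are colored by a map $\chi$ to $\Pi$ with distinct vertices of a simplex having distinct colors. A simplicial map is a vertex map carrying simplexes to simplexes; it is chromatic if it preserves colors. A carrier map sends each simplex to a subcomplex, monotonically with respect to inclusion; it is chromatic if the image of $\sigma$ is pure of dimension $\dim\sigma$ with every facet having color set $\chi[\sigma]$. A task is a triple $(\mathcal{I},\mathcal{O},\Delta)$ where $\mathcal{I},\mathcal{O}$ are finite pure chromatic complexes of dimension $n-1$ with vertices also labeled (labels $\ell$) by elements of $V^{\mathrm{in}}$, $V^{\mathrm{out}}$ respectively, each vertex being determined by its color and label ($v(p,x)$ denotes the vertex with color $p$ and label $x$), and $\Delta$ is a chromatic carrier map from $\mathcal{I}$ to $\mathcal{O}$. **System model.** $\mathsf{Exec}$ is a set of executions (sequences of configurations). Each process $p$ has a projection $\pi_p:\mathsf{Exec}\to\mathsf{View}_p$ to finite or infinite sequences of local views of $p$; the element with index $t\ge0$ is the local view right after $p$'s $t$-th step (index $0$ is the initial state). Executions are full-information: a local view contains the process's identity, its initial value, and its whole history, in particular its preceding local views. A process with only finitely many steps in $E$ is faulty, otherwise correct; $\mathsf{Correct}(E)\subseteq\mathsf{Part}(E)\subseteq\Pi$, where $\mathsf{Part}(E)$ is the set of participating processes (those taking at least one step). $\mathsf{Init}_p(E)\in V^{\mathrm{in}}$ is the initial value of $p$, and $\{v(p,\mathsf{Init}_p(E))\mid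 p\in\mathsf{Part}(E)\}$ is a simplex of $\mathcal{I}$. $\mathsf{CView}_p=\{\pi_p(E)\mid E\in\mathsf{Exec},\,p\in\mathsf{Correct}(E)\}$. **Solvability.** A protocol is a function from local views to $V^{\mathrm{out}}\cup\{\perp\}$, $\perp\notin V^{\mathrm{out}}$, such that if a view is mapped to $v\in V^{\mathrm{out}}$, all its successor views are also mapped to $v$; $\mathsf{Decision}_p(E)\in V^{\mathrm{out}}$ denotes the decision value of $p$ in $E$, if any. The task is solvable if there is a protocol such that in every $E\in\mathsf{Exec}$ every correct process has a decision value and $\{v(p,\mathsf{Decision}_p(E))\mid p\in\mathsf{Correct}(E)\}\in\Delta(\sigma)$, where $\sigma=\{v(p,\mathsf{Init}_p(E))\mid p\in\mathsf{Part}(E)\}$. It is solvable in a bounded number of local steps per process if there are such a protocol and an integer $N$ such that in every execution every correct process has decided by its local step of index $N$. **Protocol complex.** $\mathsf{CView}_p$ is equipped with the ultrametric $d_p(\alpha,\beta)=2^{-T_p(\alpha,\beta)}$, where $T_p(\alpha,\beta)$ is the smallest index at which $\alpha$ and $\beta$ differ ($\infty$ if none, with $2^{-\infty}=0$). $V(\mathcal{P})=\bigsqcup_{p\in\Pi}\mathsf{CView}_p$ with the disjoint-union metric $d$ ($d=d_p$ on $\mathsf{CView}_p$, and $d=2$ between elements of different $\mathsf{CView}_p$'s), vertices from $\mathsf{CView}_p$ being colored $p$. The simplexes of $\mathcal{P}$ are the sets $\{\pi_p(E)\mid p\in P\}$ with $E\in\mathsf{Exec}$ and $P\subseteq\mathsf{Correct}(E)$.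 Continuity of $\delta:\mathcal{P}\to\mathcal{O}$ means continuity of the vertex map $V(\mathcal{P})\to V(\mathcal{O})$, with $V(\mathcal{O})$ discrete. **Execution map.** For $\sigma\in\mathcal{I}$, $\mathsf{Compatible}(\sigma)$ is the set of $E\in\mathsf{Exec}$ with $\mathsf{Part}(E)\subseteq\chi[\sigma]$ and, for all $p\in\mathsf{Part}(E)$, $\mathsf{Init}_p(E)$ equal to the label of the vertex of $\sigma$ of color $p$. $\Xi(\sigma)=\{\{\pi_p(E)\mid p\in P\}\mid E\in\mathsf{Compatible}(\sigma),\,P\subseteq\mathsf{Correct}(E)\}$. **Finite-time complexes.** For an integer $T\ge0$ and $\alpha\in V(\mathcal{P})$ let $B_T(\alpha)=\{\beta\in V(\mathcal{P})\mid d(\alpha,\beta)<2^{-T}\}$. The vertices of $\mathcal{P}|_T$ are the open balls of radius $2^{-T}$ in the spaces $\mathsf{CView}_p$, $p\in\Pi$ (two such balls are equal or disjoint), a ball in $\mathsf{CView}_p$ being colored $p$; a set of vertices of $\mathcal{P}|_T$ is a simplex iff there is a simplex of $\mathcal{P}$ formed by choosing one element in each vertex of the set; $V(\mathcal{P}|_T)$ has the discrete topology. $\Xi_T(\sigma)=\{B_T[\tau]\mid\tau\in\Xi(\sigma)\}$, where $B_T[\tau]=\{B_T(\alpha)\mid\alpha\in\tau\}$. ''$\delta\circ\Xi$ is carried by $\Delta$'' means $\delta[\tau]\in\Delta(\sigma)$ for all $\sigma\in\mathcal{I}$ and $\tau\in\Xi(\sigma)$; similarly for $\delta_T\circ\Xi_T$.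 *)

(* Defs.v *)
From HB Require Import structures.
From mathcomp Require Import all_boot all_order all_algebra finmap.
From mathcomp Require Import all_classical all_reals.
From mathcomp Require Import topology.

Set Implicit Arguments.
Unset Strict Implicit.
Unset Printing Implicit Defensive.

Import Order.TTheory GRing.Theory Num.Theory.
Local Open Scope classical_set_scope.
Local Open Scope ring_scope.

(** * Simplicial complexes *)

(* Closure under containment makes the empty set a simplex (of dimension -1)
   of every nonempty complex. *)
Record complex (V : Type) := Complex {
  simplex : set (set V);
  simplex_finite : forall s, simplex s -> finite_set s;
  simplex_sub : forall s t, simplex s -> t `<=` s -> simplex t }.

Section Complexes.
Variables (Pi : finType) (V W : choiceType).
Implicit Types (K : complex V) (L : complex W) (s : set V).

Definition vertices K : set V := [set v | simplex K [set v]].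

Definition chromatic (chi : V -> Pi) K :=
  forall s, simplex K s -> set_inj s chi.

Definition facet K s :=
  simplex K s /\ forall t, simplex K t -> s `<=` t -> t = s.

Definition dim s : int := (#|` fset_set s|)%:Z - 1.

Definition pure (d : int) K :=
  simplex K !=set0 /\ forall s, facet K s -> dim s = d.

Definition simplicial_map K L (f : V -> W) :=
  forall s, simplex K s -> simplex L (f @` s).

Definition chromatic_map (chiV : V -> Pi) (chiW : W -> Pi) K (f : V -> W) :=
  forall v, vertices K v -> chiW (f v) = chiV v.

End Complexes.

(* The values of [D] outside the simplexes of [K] are irrelevant. *)
Definition carrier_map (V W : choiceType) (K : complex V) (L : complex W)
    (D : set V -> complex W) :=
  (forall s, simplex K s -> simplex (D s) `<=` simplex L) /\
  (forall s t, simplex K s -> simplex K t -> s `<=` t ->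
     simplex (D s) `<=` simplex (D t)).

Definition chromatic_carrier (Pi : finType) (V W : choiceType)
    (chiV : V -> Pi) (chiW : W -> Pi) (K : complex V) (D : set V -> complex W) :=
  forall s, simplex K s ->
    pure (dim s) (D s) /\
    forall t, facet (D s) t -> chiW @` t = chiV @` s.

(** * Tasks *)

(* The vertex v(p, x) is the pair (p, x), with color [fst] and label [snd]. *)
Record task (Pi : finType) (Vin Vout : choiceType) := Task {
  inputs : complex (Pi * Vin)%type;
  outputs : complex (Pi * Vout)%type;
  spec : set (Pi * Vin) -> complex (Pi * Vout)%type;
  inputs_finite : finite_set (simplex inputs);
  outputs_finite : finite_set (simplex outputs);
  inputs_chromatic : chromatic fst inputs;
  outputs_chromatic : chromatic fst outputs;
  inputs_pure : pure (#|Pi|%:Z - 1) inputs;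
  outputs_pure : pure (#|Pi|%:Z - 1) outputs;
  spec_carrier : carrier_map inputs outputs spec;
  spec_chromatic : chromatic_carrier fst fst inputs spec }.

(** * Executions *)

(* Finite or infinite sequences. *)
Inductive fiseq (A : Type) := FinSeq of seq A | InfSeq of (nat -> A).

HB.instance Definition _ (A : Type) := gen_eqMixin (fiseq A).
HB.instance Definition _ (A : Type) := gen_choiceMixin (fiseq A).

Section FiSeq.
Variable A : Type.
Implicit Types a b : fiseq A.

Definition item a (t : nat) : option A :=
  match a with FinSeq s => onth s t | InfSeq f => Some (f t) end.

Definition infinite_seq a := if a is InfSeq _ then True else False.

Lemma item_inj a b : item a =1 item b -> a = b.
Proof.
have onth_over (s : seq A) : onth s (size s) = None.
  by elim: s => //= x s <-.
case: a b => [s|f] [s'|f'] /= eq_ab.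
- congr FinSeq; elim: s s' eq_ab => [|x s IH] [|y s'] //= eq_ab.
  + by have := eq_ab 0.
  + by have := eq_ab 0.
  + have [->] := eq_ab 0.
    by congr cons; apply: IH => t; apply: (eq_ab t.+1).
- by have /= := eq_ab (size s); rewrite onth_over.
- by have /= := eq_ab (size s'); rewrite onth_over.
- by congr InfSeq; apply/funext => t; have [] := eq_ab t.
Qed.

Definition differ a b : pred nat := fun t => `[< item a t <> item b t >].

(* T(a, b); [None] stands for infinity. *)
Definition first_diff a b : option nat :=
  if pselect (exists t, differ a b t) is left h then Some (ex_minn h) else None.

Definition seq_dist (R : realType) a b : R :=
  if first_diff a b is Some t then 2 ^- t else 0.

End FiSeq.

(* Executions are sequences of configurations.  [proj p E] is the sequence of
   local views of [p] in [E]: its item of index [t] is the view right after the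
   [t]-th step of [p], item 0 being the initial state, which always exists. *)
Record system (Pi : finType) (Vin : choiceType) := System {
  config : Type;
  lview : Type;
  Exec : set (fiseq config);
  proj : Pi -> fiseq config -> fiseq lview;
  init : Pi -> fiseq config -> Vin;
  proj0 : forall p E, Exec E -> item (proj p E) 0 <> None }.

Arguments proj {Pi Vin} s p E.
Arguments init {Pi Vin} s p E.
Arguments Exec {Pi Vin} s.

Section Executions.
Variables (Pi : finType) (Vin : choiceType) (M : system Pi Vin).

Definition Part (E : fiseq (config M)) : set Pi :=
  [set p | item (proj M p E) 1 <> None].

Definition Correct (E : fiseq (config M)) : set Pi :=
  [set p | infinite_seq (proj M p E)].

Lemma Correct_sub_Part E : Correct E `<=` Part E.
Proof. by move=> p; rewrite /Correct /Part /=; case: (proj M p E). Qed.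

(* The process, its initial value, and the list of its preceding local views
   can be read off every local view occurring in an execution. *)
Definition full_information :=
  exists (ident : lview M -> Pi) (initial : lview M -> Vin)
         (history : lview M -> seq (lview M)),
  forall E p t x, Exec M E -> item (proj M p E) t = Some x ->
    [/\ ident x = p, initial x = init M p E
      & map Some (history x) = mkseq (item (proj M p E)) t].

Definition input_simplex (E : fiseq (config M)) : set (Pi * Vin) :=
  [set v | Part E v.1 /\ v.2 = init M v.1 E].

Definition inits_in (I : complex (Pi * Vin)%type) :=
  forall E, Exec M E -> simplex I (input_simplex E).

Definition CView (p : Pi) : set (fiseq (lview M)) :=
  [set a | exists E, [/\ Exec M E, Correct E p & a = proj M p E]].

End Executions.

Arguments CView {Pi Vin} M p.

(** * Solvability *)

Section Solvability.
Variables (Pi : finType) (Vin Vout : choiceType).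
Variables (Tk : task Pi Vin Vout) (M : system Pi Vin).
Implicit Types (f : lview M -> option Vout) (E : fiseq (config M)).

Definition successor (x y : lview M) :=
  exists E p s t, [/\ Exec M E, (s <= t)%N,
    item (proj M p E) s = Some x & item (proj M p E) t = Some y].

(* [None] stands for the absence of a decision. *)
Definition protocol f :=
  forall x y w, successor x y -> f x = Some w -> f y = Some w.

Definition decided_at f E (p : Pi) (t : nat) (w : Vout) :=
  exists x, item (proj M p E) t = Some x /\ f x = Some w.

(* Decision_p(E) is defined and equal to [w]; by stability of protocols there
   is at most one such [w]. *)
Definition decision f E (p : Pi) (w : Vout) := exists t, decided_at f E p t w.

Definition solves f :=
  forall E, Exec M E ->
    (forall p, Correct E p -> exists w, decision f E p w) /\
    simplex (spec Tk (input_simplex E))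
      [set v | Correct E v.1 /\ decision f E v.1 v.2].

Definition solvable := exists f, protocol f /\ solves f.

Definition boundedly_solvable :=
  exists f (N : nat), [/\ protocol f, solves f &
    forall E p, Exec M E -> Correct E p ->
      exists2 t, (t <= N)%N & exists w, decided_at f E p t w].

End Solvability.

(** * The protocol complex *)

(* The disjoint union of the sets [CView M p].  The parameter [R] only
   serves to let the metric structure be inferred from the type. *)
Definition pvertex (R : realType) (Pi : finType) (Vin : choiceType)
  (M : system Pi Vin) := {p : Pi & CView M p}.

HB.instance Definition _ (R : realType) (Pi : finType) (Vin : choiceType)
  (M : system Pi Vin) := Choice.on (pvertex R M).

Section PVertexMetric.
Variables (R : realType) (Pi : finType) (Vin : choiceType).
Variable M : system Pi Vin.
Implicit Types x y z : pvertex R M.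

Definition color x : Pi := tag x.
Definition view x : fiseq (lview M) := \val (tagged x).

Definition pdist x y : R :=
  if color x == color y then seq_dist R (view x) (view y) else 2.

Lemma pvertexP x : CView M (color x) (view x).
Proof. by case: x => p [a ap]; exact: (set_mem ap). Qed.

Lemma pvertex_inj x y : color x = color y -> view x = view y -> x = y.
Proof.
case: x y => [p a] [q b]; rewrite /color /view /= => epq.
by case: _ / epq b => b /val_inj ->.
Qed.

Variant seq_dist_spec (A : Type) (a b : fiseq A) : R -> Prop :=
| SeqDistEq of a = b : seq_dist_spec a b 0
| SeqDistDiff t of item a t <> item b t
    & (forall s, (s < t)%N -> item a s = item b s) : seq_dist_spec a b (2 ^- t).

Lemma seq_distP (A : Type) (a b : fiseq A) : seq_dist_spec a b (seq_dist R a b).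
Proof.
rewrite /seq_dist /first_diff; case: pselect => [h|h].
  case: ex_minnP => t /asboolP ht min_t; constructor=> // s lt_st.
  apply: contrapT => hs; have := min_t s; rewrite leqNgt lt_st => H.
  by have: false by apply: H; apply/asboolP.
constructor; apply: item_inj => t; apply: contrapT => ht.
by apply: h; exists t; apply/asboolP.
Qed.

Lemma le_exp2 (s t : nat) : (2 ^- t <= 2 ^- s :> R) = (s <= t)%N.
Proof. by rewrite lef_pV2 ?posrE ?exprn_gt0// ler_eXn2l// ltr1n. Qed.

Lemma seq_dist_lt (A : Type) (a b : fiseq A) T :
  seq_dist R a b < 2 ^- T <-> (forall t, (t <= T)%N -> item a t = item b t).
Proof.
case: seq_distP => [->|t ne_t eq_lt].
  by split=> // _; rewrite invr_gt0 exprn_gt0.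
rewrite ltNge le_exp2 -ltnNge; split=> [lt_Tt s le_sT|eqT].
  by apply: eq_lt; apply: leq_ltn_trans lt_Tt.
by rewrite ltnNge; apply/negP => /eqT.
Qed.

Lemma seq_dist_ge0 (A : Type) (a b : fiseq A) : 0 <= seq_dist R a b.
Proof. by case: seq_distP => // t _ _; rewrite invr_ge0 exprn_ge0. Qed.

Lemma seq_dist_le1 (A : Type) (a b : fiseq A) : seq_dist R a b <= 1.
Proof.
case: seq_distP => // t _ _.
by rewrite -[leRHS]invr1 -(expr0 (2 : R)) le_exp2.
Qed.

Lemma seq_dist_ge (A : Type) (a b : fiseq A) t :
  item a t <> item b t -> 2 ^- t <= seq_dist R a b.
Proof.
by move=> ne_t; rewrite leNgt; apply/negP => /seq_dist_lt/(_ t (leqnn t)).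
Qed.

Lemma seq_dist_sym (A : Type) (a b : fiseq A) : seq_dist R a b = seq_dist R b a.
Proof.
suff le_ab (c d : fiseq A) : seq_dist R c d <= seq_dist R d c.
  by apply/eqP; rewrite eq_le !le_ab.
case: (seq_distP c d) => [_|t ne_t _]; first exact: seq_dist_ge0.
by apply: seq_dist_ge => /esym.
Qed.

Lemma seq_dist_triangle (A : Type) (b a c : fiseq A) :
  seq_dist R a c <= seq_dist R a b + seq_dist R b c.
Proof.
case: (seq_distP a c) => [_|t ne_t _]; first by rewrite addr_ge0 ?seq_dist_ge0.
have [eq_ab|ne_ab] := pselect (item a t = item b t).
  by rewrite ler_wpDl ?seq_dist_ge0// seq_dist_ge// -eq_ab.
by rewrite ler_wpDr ?seq_dist_ge0// seq_dist_ge.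
Qed.

Lemma pdistxx x : pdist x x = 0.
Proof. by rewrite /pdist eqxx; case: seq_distP. Qed.

Lemma pdist_positivity x y : pdist x y = 0 -> x = y.
Proof.
rewrite /pdist; case: eqP => [exy|_ /eqP]; last by rewrite pnatr_eq0.
case: seq_distP => [vxy _|t _ _ /eqP]; first exact: pvertex_inj.
by rewrite invr_eq0 expf_eq0 pnatr_eq0 andbF.
Qed.

Lemma pdist_sym x y : pdist x y = pdist y x.
Proof. by rewrite /pdist eq_sym seq_dist_sym. Qed.

Lemma pdist_triangle y x z : pdist x z <= pdist x y + pdist y z.
Proof.
have ge0 u v : 0 <= pdist u v.
  by rewrite /pdist; case: ifP => // _; exact: seq_dist_ge0.
have le2 u v : pdist u v <= 2.
  rewrite /pdist; case: ifP => // _.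
  by rewrite (le_trans (seq_dist_le1 _ _))// ler1n.
have [exy|nxy] := eqVneq (color x) (color y); last first.
  by rewrite {2}/pdist (negPf nxy) ler_wpDr ?ge0.
have [eyz|nyz] := eqVneq (color y) (color z); last first.
  by rewrite [pdist y z]/pdist (negPf nyz) ler_wpDl ?ge0.
by rewrite /pdist exy eyz eqxx seq_dist_triangle.
Qed.

HB.instance Definition _ := @isMetric.Build R (pvertex R M) pdist
  pdistxx pdist_positivity pdist_sym pdist_triangle.

End PVertexMetric.

Section ProtocolComplex.
Variables (R : realType) (Pi : finType) (Vin : choiceType).
Variable M : system Pi Vin.
Local Notation VP := (pvertex R M).

(* For P included in Correct(E), the set of the views of the p in P. *)
Definition views_of (E : fiseq (config M)) (P : set Pi) : set VP :=
  [set x | P (color x) /\ view x = proj M (color x) E].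

Definition psimplex : set (set VP) :=
  [set s | exists E P, [/\ Exec M E, P `<=` Correct E & s = views_of E P]].

Lemma views_of_inj E P : set_inj (views_of E P) (@color R Pi Vin M).
Proof.
move=> x y /set_mem[_ vx] /set_mem[_ vy] exy.
by apply: pvertex_inj => //; rewrite vx vy exy.
Qed.

Lemma psimplex_finite s : psimplex s -> finite_set s.
Proof.
move=> [E [P [_ _ ->]]]; rewrite -(eq_finite_set (inj_card_eq (@views_of_inj E P))).
exact: finite_finset.
Qed.

Lemma psimplex_sub s t : psimplex s -> t `<=` s -> psimplex t.
Proof.
move=> [E [P [EE PE ->]]] tP.
exists E, (@color R Pi Vin M @` t); split=> //.
  by move=> _ [x /tP[Px _] <-]; exact: PE.
apply/seteqP; split=> [x tx|x [[y ty eyx] vx]].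
  by split; [exists x | have [] := tP _ tx].
have [_ vy] := tP _ ty.
by have <- : y = x by apply: pvertex_inj => //; rewrite vy vx eyx.
Qed.

Definition protocol_complex : complex VP := Complex psimplex_finite psimplex_sub.

Definition Compatible (sigma : set (Pi * Vin)) : set (fiseq (config M)) :=
  [set E | [/\ Exec M E, Part E `<=` fst @` sigma &
    forall p v, Part E p -> sigma v -> v.1 = p -> init M p E = v.2]].

Definition exec_map (sigma : set (Pi * Vin)) : set (set VP) :=
  [set s | exists E P,
    [/\ Compatible sigma E, P `<=` Correct E & s = views_of E P]].

(** ** Finite-time complexes *)

Variable T : nat.

(* Distances between colors being 2, B_T(x) lies within one [CView M p]. *)
Definition tball (x : VP) : set VP := ball x (2 ^- T).

Definition tvertex := {B : set VP | B \in range tball}.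

HB.instance Definition _ := Choice.on tvertex.

Definition to_tvertex (x : VP) : tvertex :=
  exist _ (tball x) (mem_set (imageT tball x)).

(* The color does not depend on the chosen center: see [tcolorE]. *)
Definition center (B : tvertex) : VP := s2val (cid2 (set_mem (svalP B))).

Definition tcolor (B : tvertex) : Pi := color (center B).

Lemma tballE x y : tball x y <->
  color x = color y /\ forall t, (t <= T)%N -> item (view x) t = item (view y) t.
Proof.
rewrite /tball ballEmdist /=; change (mdist x y) with (pdist x y).
rewrite /pdist; case: eqP => [exy|nxy].
  by rewrite seq_dist_lt; split=> [|[]].
split=> [lt2|[]//]; have: (2 : R) < 1.
  by apply: lt_le_trans lt2 _; rewrite -[leRHS]invr1 -(expr0 (2 : R)) le_exp2.
by rewrite -[ltRHS]/(1%:R) ltr_nat.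
Qed.

Lemma tball_eq x y : tball x y -> tball x = tball y.
Proof.
move=> /tballE[exy vxy]; apply/seteqP; split=> z /tballE[ez vz]; apply/tballE.
  by split=> [|t tT]; [rewrite -exy | rewrite -vxy// vz].
by split=> [|t tT]; [rewrite exy | rewrite vxy// vz].
Qed.

Lemma centerK B : to_tvertex (center B) = B.
Proof. by apply: val_inj; rewrite /= /center; case: cid2. Qed.

Lemma tvertexP (B : tvertex) x : sval B x -> B = to_tvertex x.
Proof.
rewrite -{1 2}[B]centerK /= => /tball_eq eB.
by apply: val_inj; rewrite /= eB.
Qed.

Lemma tcolorE (B : tvertex) x : sval B x -> tcolor B = color x.
Proof. by rewrite -{1}[B]centerK /= => /tballE[]. Qed.

Definition tsimplex : set (set tvertex) :=
  [set S | exists c : tvertex -> VP,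
    (forall B, S B -> sval B (c B)) /\ psimplex (c @` S)].

Lemma tsimplex_finite S : tsimplex S -> finite_set S.
Proof.
move=> [c [cS /psimplex_finite]]; rewrite (eq_finite_set (inj_card_eq _))//.
move=> B B' /set_mem SB /set_mem SB' ecB.
by rewrite (tvertexP (cS _ SB)) ecB -(tvertexP (cS _ SB')).
Qed.

Lemma tsimplex_sub S S' : tsimplex S -> S' `<=` S -> tsimplex S'.
Proof.
move=> [c [cS sS]] S'S; exists c; split=> [B /S'S/cS//|].
by apply: psimplex_sub sS _; exact: image_subset.
Qed.

Definition time_complex : complex tvertex := Complex tsimplex_finite tsimplex_sub.

Definition time_exec_map (sigma : set (Pi * Vin)) : set (set tvertex) :=
  [set to_tvertex @` s | s in exec_map sigma].

End ProtocolComplex.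

Definition carried_by (V W U : choiceType) (I : complex V)
    (D : set V -> complex W) (Xi : set V -> set (set U)) (delta : U -> W) :=
  forall sigma tau, simplex I sigma -> Xi sigma tau ->
    simplex (D sigma) (delta @` tau).

(* Main.v *)
Require Import Defs.
From mathcomp Require Import all_boot all_order all_algebra.
From mathcomp Require Import all_classical all_reals.
From mathcomp Require Import topology.

Import Order.TTheory GRing.Theory Num.Theory.

Local Open Scope classical_set_scope.
Local Open Scope ring_scope.

(** The decision of a correct process is already determined by a finite prefix
    of its sequence of views, so a protocol is the same thing as a locally
    constant map on the views of the correct processes.  By compactness a
    locally constant map is constant on all balls of some common radius
    2^-T, that is, it factors through the vertices of P|_T.  Conversely, since
    a local view of index at least T contains the whole history, it determines
    the ball of radius 2^-T around any sequence through it, and a process can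
    decide at index T. *)

Section Executions.
Set Implicit Arguments.
Unset Strict Implicit.
Variables (Pi : finType) (Vin Vout : choiceType).
Variables (Tk : task Pi Vin Vout) (M : system Pi Vin).
Implicit Types (E : fiseq (config M)) (p : Pi) (f : lview M -> option Vout).

(** * Inputs, decisions and histories in executions *)

Lemma compatible_input_simplex E : Exec M E -> Compatible (input_simplex E) E.
Proof.
move=> EE; split=> // [p pE|p v pE [_ eqv] <- //].
by exists (p, init M p E).
Qed.

Lemma input_simplex_sub E sigma :
  Compatible sigma E -> input_simplex E `<=` sigma.
Proof.
move=> [_ sub eq_init] [p w] [/= pE ->].
have [[q u] su /= eqp] := sub _ pE.
by rewrite (eq_init _ _ pE su eqp) -eqp.
Qed.

Lemma decision_uniq f E p w w' :
  Exec M E -> protocol f -> decision f E p w -> decision f E p w' -> w = w'.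
Proof.
move=> EE pf [s [x [xs fx]]] [t [y [yt fy]]].
have [le_st|lt_ts] := leqP s t.
  have xy : successor x y by exists E, p, s, t.
  by move: (pf _ _ _ xy fx); rewrite fy => -[].
have yx : successor y x by exists E, p, t, s; split=> //; exact: ltnW.
by move: (pf _ _ _ yx fy); rewrite fx => -[].
Qed.

(** The history in a local view lists exactly the preceding views, so its length recovers the index
    of the view and its entries recover all earlier items. *)
Lemma item_history (full : full_information M) E E' p p' t t' x :
  Exec M E -> Exec M E' ->
  item (Defs.proj M p E) t = Some x -> item (Defs.proj M p' E') t' = Some x ->
  [/\ p = p', t = t' &
    forall s, (s <= t)%N -> item (Defs.proj M p E) s =
      item (Defs.proj M p' E') s].
Proof.
move=> EE EE' xt xt'; have [ident [initial [hist hP]]] := full.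
have [ep _ ht] := hP _ _ _ _ EE xt; have [ep' _ ht'] := hP _ _ _ _ EE' xt'.
have eq_t : t = t'.
  by rewrite -(size_mkseq (item (Defs.proj M p E)) t) -ht ht' size_mkseq.
subst t'; split=> [|//|s]; first by rewrite -ep ep'.
rewrite leq_eqVlt => /orP[/eqP->|lt_st]; first by rewrite xt.
by rewrite -(nth_mkseq None (item _) lt_st) -ht ht' nth_mkseq.
Qed.

Section Vertices.
Variable R : realType.
Local Notation VP := (pvertex R M).

(** * Vertices and balls of the protocol complex *)

Lemma correct_vertex E p : Exec M E -> Correct E p ->
  exists2 x : VP, color x = p & view x = Defs.proj M p E.
Proof.
move=> EE cE; have ap : CView M p (Defs.proj M p E) by exists E.
by exists (existT _ p (SigSub (mem_set ap))).
Qed.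

(** This lets [chromatic_map], which only concerns vertices, be applied at every point of the
    type. *)
Lemma pvertex_vertex (x : VP) : vertices (protocol_complex R M) x.
Proof.
have [E [EE cE vE]] := pvertexP x.
exists E, [set color x]; split=> //; first by move=> _ ->.
apply/seteqP; split=> [_ ->//|y [eyx vy]].
by apply: pvertex_inj => //; rewrite vy vE eyx.
Qed.

Lemma tvertex_vertex T (B : tvertex R M T) : vertices (time_complex R M T) B.
Proof.
exists (@center R Pi Vin M T); split=> [C _|]; last first.
  by rewrite image_set1; exact: pvertex_vertex.
by rewrite /center; case: cid2 => /= y _ <-; apply/tballE.
Qed.

Lemma tballT_sub S T (x y : VP) : (S <= T)%N -> tball T x y -> tball S x y.
Proof.
move=> le_ST /tballE[exy vxy]; apply/tballE; split=> // t tS.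
by apply: vxy; exact: leq_trans le_ST.
Qed.

Lemma to_tvertex_eq T (x y : VP) :
  tball T x y -> to_tvertex T x = to_tvertex T y.
Proof. by move=> xy; apply: tvertexP; apply/tballE; have /tballE[] := xy. Qed.

Lemma nbhs_tball T (x : VP) : nbhs x (tball T x).
Proof. by apply: nbhsx_ballx; rewrite invr_gt0 exprn_gt0. Qed.

Lemma nbhs_tball_basis (x : VP) (A : set VP) :
  nbhs x A -> exists T, tball T x `<=` A.
Proof.
move=> /nbhs_ballP[e /= e_gt0 eA].
(* This exponent [T] satisfies [e^-1 < 2 ^+ T]. *)
exists (Num.bound e^-1) => y; rewrite /tball => xy; apply: eA.
apply: le_ball xy; rewrite invf_ple ?posrE ?exprn_gt0//.
exact/ltW/upper_nthrootP.
Qed.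

Lemma uniform_radius (D : choiceType) (delta : VP -> discrete_topology D) :
  compact [set: VP] -> continuous delta ->
  exists T, forall x y, tball T x y -> delta x = delta y.
Proof.
move=> /compact_near_coveringP cpt cts.
pose P T x := forall y, tball T x y -> delta x = delta y.
(* Near-covering compactness turns a bound on [T] valid near each point into one valid
   everywhere. *)
have [x _|T _ /(_ T (leqnn T)) PT] := cpt nat \oo P _; last first.
  by exists T => x; exact: PT.
have [N NA] := nbhs_tball_basis (cts x _ (discrete_set1 (delta x))).
exists (tball N x, [set T | (N <= T)%N]) => /=.
  by split; [exact: nbhs_tball | exists N].
move=> [y T] /= [xy NT] z /(tballT_sub NT) yz.
(* In an ultrametric space every point of a ball is a center of it, so [z] stays in the ball where
   [delta] is constant. *)
have xz : tball N x z by rewrite (tball_eq xy).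
by rewrite (NA _ xy) (NA _ xz).
Qed.

(** * Passing between protocols and simplicial maps *)

Definition solution_map (delta : VP -> Pi * Vout) :=
  [/\ chromatic_map (@color R Pi Vin M) fst (protocol_complex R M) delta,
      simplicial_map (protocol_complex R M) (outputs Tk) delta
    & carried_by (inputs Tk) (spec Tk) (@exec_map R Pi Vin M) delta].

Definition time_solution_map T (delta : tvertex R M T -> Pi * Vout) :=
  [/\ chromatic_map (@tcolor R Pi Vin M T) fst (time_complex R M T) delta,
      simplicial_map (time_complex R M T) (outputs Tk) delta
    & carried_by (inputs Tk) (spec Tk) (@time_exec_map R Pi Vin M T) delta].

Lemma solution_map_of_protocol f :
  inits_in M (inputs Tk) -> protocol f -> solves Tk f ->
  exists2 delta : VP -> discrete_topology (Pi * Vout)%type,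
    continuous delta & solution_map delta.
Proof.
move=> inits pf sf.
(* All executions giving [x] share the views of its process, so the decision does not depend on the
   execution. *)
have [delta deltaP] : {delta : VP -> Pi * Vout & forall x,
    (delta x).1 = color x /\ forall E, Exec M E -> view x = Defs.proj M (color x) E ->
      decision f E (color x) (delta x).2}.
  apply: (@choice _ _ (fun x v => v.1 = color x /\
    forall E, Exec M E -> view x = Defs.proj M (color x) E ->
      decision f E (color x) v.2)) => x.
  have [E [EE cE vE]] := pvertexP x.
  have [w dw] := (sf E EE).1 _ cE.
  exists (color x, w); split=> // E' EE' /= vE'.
  by rewrite /decision /decided_at -vE' vE.
have delta_spec E (P : set Pi) : Exec M E -> P `<=` Correct E ->
    simplex (spec Tk (input_simplex E)) (delta @` views_of E P).
  move=> EE PE; apply: simplex_sub (sf E EE).2 _ => _ [x [Px vx] <-].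
  have [dx1 dx2] := deltaP x; split=> /=; rewrite dx1; first exact: PE.
  exact: dx2.
have [spec_out spec_mono] := spec_carrier Tk.
exists delta; last split.
(* The decision is taken at some index [t], and all points of the ball of radius 2^-t share the
   deciding view. *)
- move=> x A /nbhs_singleton Adx.
  have [E [EE cE vE]] := pvertexP x.
  have [dx1 dx2] := deltaP x; have [t [v [vt fv]]] := dx2 _ EE vE.
  apply: filterS (nbhs_tball t x) => y /tballE[exy vxy] /=.
  suff -> : delta y = delta x by [].
  have [dy1 dy2] := deltaP y.
  have [E' [EE' cE' vE']] := pvertexP y.
  have dec_y : decision f E' (color y) (delta x).2.
    by exists t, v; split=> //; rewrite -vE' -vxy ?vE.
  rewrite [LHS]surjective_pairing [RHS]surjective_pairing dx1 dy1 exy.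
  by rewrite (decision_uniq EE' pf (dy2 _ EE' vE') dec_y).
- by move=> x _; have [] := deltaP x.
- move=> _ [E [P [EE PE ->]]].
  by apply: spec_out (inits _ EE) _ (delta_spec _ _ EE PE).
- move=> sigma _ Isigma [E [P [cE PE ->]]]; have [EE _ _] := cE.
  (* The inputs of [E] form a face of [sigma], so monotonicity of the carrier map suffices. *)
  apply: (spec_mono _ _ (inits _ EE) Isigma (input_simplex_sub cE)).
  exact: delta_spec.
Qed.

Lemma time_solution_map_of_uniform T (delta : VP -> Pi * Vout) :
  (forall x y, tball T x y -> delta x = delta y) -> solution_map delta ->
  time_solution_map (delta \o @center R Pi Vin M T).
Proof.
move=> unif [chi sim car].
(* Any representative of a ball may thus replace its arbitrarily chosen center. *)
have centerP (B : tvertex R M T) x : sval B x -> delta (center B) = delta x.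
  by rewrite -{1}[B]centerK => /unif.
split=> [B _|S [c [cS /sim sc]]|sigma _ Isigma [s Xs <-]].
- exact/chi/pvertex_vertex.
- suff -> : (delta \o @center R Pi Vin M T) @` S = delta @` (c @` S) by [].
  by rewrite image_comp; apply: eq_imagel => B SB; exact/centerP/cS.
- suff -> : (delta \o @center R Pi Vin M T) @` (to_tvertex T @` s) = delta @` s.
    exact: car.
  by rewrite image_comp; apply: eq_imagel => x _ /=; apply/centerP/tballE.
Qed.

Lemma protocol_of_time_solution_map T (delta : tvertex R M T -> Pi * Vout) :
  full_information M -> inits_in M (inputs Tk) -> time_solution_map delta ->
  boundedly_solvable Tk M.
Proof.
move=> full inits [chi sim car].
(* The execution [E] need not be the one that makes [v] a vertex: asking for
   the color of [v] to be correct in [E] would break the stability of decisions,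
   as a view can be followed by views that only occur in faulty processes. *)
pose dec x w := exists E t v, [/\ Exec M E, (T <= t)%N,
  item (Defs.proj M (color v) E) t = Some x,
  (forall s, (s <= T)%N -> item (Defs.proj M (color v) E) s = item (view v) s)
  & w = (delta (to_tvertex T v)).2].
(* Two witnesses for the same view have the same color and agree up to index [T], hence lie in the
   same ball. *)
have dec_uniq x w w' : dec x w -> dec x w' -> w = w'.
  move=> [E [t [v [EE Tt xt eqE ->]]]] [E' [t' [v' [EE' _ xt' eqE' ->]]]].
  have [evv' _ eqEE'] := item_history full EE EE' xt xt'.
  congr (delta _).2; apply/to_tvertex_eq/tballE; split=> // s sT.
  by rewrite -eqE// -eqE'// eqEE'// (leq_trans sT).
pose f x := if pselect (exists w, dec x w) is left h then Some (sval (cid h))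
  else None.
have fP x w : f x = Some w <-> dec x w.
  rewrite /f; case: pselect => [h|nh]; last by split=> // dw; case: nh; exists w.
  case: cid => w' /= dw'; split=> [[<-//]|dw].
  by rewrite (dec_uniq _ _ _ dw dw').
(* Here [x] itself is the witness; its view is infinite, so it has an item of index [T]. *)
have decided E (x : VP) : Exec M E -> view x = Defs.proj M (color x) E ->
    decided_at f E (color x) T (delta (to_tvertex T x)).2.
  move=> EE vx; have [E' [_ cE' vE']] := pvertexP x.
  have [y yT] : exists y, item (Defs.proj M (color x) E) T = Some y.
    rewrite -vx vE'; move: cE'; rewrite /Correct /=.
    by case: (Defs.proj M _ E') => // h _; exists (h T).
  exists y; split=> //; apply/fP; exists E, T, x; split=> // s _.
  by rewrite vx.
have pf : protocol f.
  move=> x y w [E [p [s [t [EE st xs yt]]]]].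
  move=> /fP[E' [t' [v [EE' Tt' xt' eqE' ->]]]].
  apply/fP; have [ep es eqEE'] := item_history full EE EE' xs xt'; subst p t'.
  (* The witness [v] carries over to the later view, since the history of [x] fixes all items up to
     [T]. *)
  exists E, t, v; split=> // [|r rT]; first exact: leq_trans st.
  by rewrite eqEE' ?eqE'// (leq_trans rT).
have sf : solves Tk f.
  move=> E EE; split=> [p cE|].
    have [x <- vx] := correct_vertex EE cE; exists (delta (to_tvertex T x)).2.
    by exists T; apply: decided => //; rewrite vx; congr Defs.proj.
  have cE := compatible_input_simplex EE.
  have : @time_exec_map R Pi Vin M T (input_simplex E)
    (to_tvertex T @` views_of E (Correct E)).
    exists (views_of E (Correct E)); last by [].
    by exists E, (Correct E); split.
  move=> /(car _ _ (inits _ EE)).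
  (* With all correct processes taken, the image under [delta] is the whole set of decisions,
     because decisions are unique. *)
  congr simplex; apply/seteqP; split=> [_ [_ [x [cx vx] <-] <-]|[p w] [/= cp dw]].
    have -> : delta (to_tvertex T x) = (color x, (delta (to_tvertex T x)).2).
      rewrite [LHS]surjective_pairing; congr pair.
      rewrite (chi _ (tvertex_vertex _)); apply/tcolorE; exact/tballE.
    by split=> //=; exists T; exact: decided.
  have [x ex vx] := correct_vertex EE cp; subst p.
  exists (to_tvertex T x); first by exists x.
  rewrite [LHS]surjective_pairing; congr pair.
    rewrite (chi _ (tvertex_vertex _)); apply/tcolorE; exact/tballE.
  by apply: (decision_uniq EE pf _ dw); exists T; apply: decided.
exists f, T; split=> // E p EE cE; exists T => //.
have [x <- vx] := correct_vertex EE cE; exists (delta (to_tvertex T x)).2.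
exact: decided.
Qed.

End Vertices.
End Executions.

(* In item 2, V(O) is a set of pairs in Pi * Vout, and [delta] takes its values
   in V(O) because it is simplicial. *)
Theorem theorem6p3 (R : realType) (Pi : finType) (Vin Vout : choiceType)
    (Tk : task Pi Vin Vout) (M : system Pi Vin)
    (full : full_information M)
    (inits : inits_in M (inputs Tk))
    (cpt : compact [set: pvertex R M]) :
  [<-> solvable Tk M;

       exists delta : pvertex R M -> discrete_topology (Pi * Vout)%type,
         [/\ continuous delta,
             chromatic_map (@color R Pi Vin M) fst (protocol_complex R M) delta,
             simplicial_map (protocol_complex R M) (outputs Tk) delta
           & carried_by (inputs Tk) (spec Tk) (@exec_map R Pi Vin M) delta];

       exists (T : nat) (delta : tvertex R M T -> (Pi * Vout)%type),
         [/\ chromatic_map (@tcolor R Pi Vin M T) fst (time_complex R M T) delta,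
             simplicial_map (time_complex R M T) (outputs Tk) delta
           & carried_by (inputs Tk) (spec Tk) (@time_exec_map R Pi Vin M T) delta];

       boundedly_solvable Tk M].
Proof.
tfae.
- move=> [f [pf sf]].
  have [delta cts [chi sim car]] := solution_map_of_protocol R inits pf sf.
  by exists delta.
- move=> [delta [cts chi sim car]]; have [T unif] := uniform_radius cpt cts.
  exists T, (delta \o @center R Pi Vin M T).
  exact: time_solution_map_of_uniform.
- by move=> [T [delta sol]]; exact: protocol_of_time_solution_map sol.
- by move=> [f [N [pf sf _]]]; exists f.
Qed.
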